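(* Let $K$ be a field. The interleaving distance $d_I$ of sheaves on $\mathbb{R}$ taking values in the category of $K$-vector spaces and the induced intrinsic interleaving distance $\hat d_I$ differ globally by at least a factor of $2$; that is, any constant $c\ge0$ such that $\hat d_I(F,G)\le c\cdot d_I(F,G)$ for all sheaves $F,G$ of $K$-vector spaces on $\mathbb{R}$ satisfies $c\ge2$.
   Context: Let $\mathcal{I}$ be the poset (under inclusion) of open intervals $(a,b)\subseteq\mathbb{R}$, with $-\infty\le a<b\le\infty$. Since $\mathcal{I}$ is a basis of the topology of $\mathbb{R}$, sheaves on $\mathbb{R}$ are regarded as contravariant functors on $\mathcal{I}$ satisfying the sheaf condition. For $\delta\ge0$ let $\Omega_\delta\colon\mathcal{I}\to\mathcal{I}$, $(a,b)\mapsto(a-\delta,b+\delta)$. For a presheaf $F$ on $\mathcal{I}$, the restriction maps along $I\subseteq\Omega_\delta(I)$ form a natural transformation $F\circ\Omega_{0\le\delta}\colon F\circ\Omega_\delta\to F$. A $\delta$-interleaving of presheaves $F$ and $G$ is a pair of presheaf homomorphisms $\varphi\colon G\circ\Omega_\delta\to F$ and $\psi\colon F\circ\Omega_\delta\to G$ with $\varphi\circ(\psi\circ\Omega_\delta)=F\circ\Omega_{0\le2\delta}$ and $\psi\circ(\varphi\circ\Omega_\delta)=G\circ\Omega_{0\le2\delta}$, where $\psi\circ\Omega_\delta\colon F\circ\Omega_{2\delta}\to G\circ\Omega_\delta$ is $\psi$ whiskered with $\Omega_\delta$, and similarly for $\varphi$. The interleaving distance $d_I(F,G)$ is the infimum of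 all $\delta\ge0$ such that $F$ and $G$ are $\delta$-interleaved ($\infty$ if there are none). The induced intrinsic distance $\hat d_I(F,G)$ is the infimum of the lengths (with respect to $d_I$) of all $d_I$-continuous paths of such sheaves from $F$ to $G$ parametrized by a compact interval, where the length of a path $\gamma$ is $\sup\sum_i d_I(\gamma(t_{i-1}),\gamma(t_i))$ over all finite subdivisions $t_0<t_1<\dots<t_k$ of the parameter interval. *)

(* Defs.v *)
From HB Require Import structures.
From mathcomp Require Import all_boot all_order all_algebra.
From mathcomp Require Import all_classical all_reals all_analysis.

Set Implicit Arguments.
Unset Strict Implicit.
Unset Printing Implicit Defensive.

Import Order.TTheory GRing.Theory Num.Theory.

Local Open Scope classical_set_scope.
Local Open Scope ring_scope.

Section intervals.
Variable R : realType.

(* The nonempty open intervals ]a, b[ of R with extended real endpoints. *)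
Record oitv := OItv {
  lo : \bar R;
  hi : \bar R;
  lo_lt_hi : (lo < hi)%E }.

Definition oitv_set (I : oitv) : set R := [set x | (lo I < x%:E < hi I)%E].

Definition oitv_sub (I J : oitv) : Prop := oitv_set I `<=` oitv_set J.

Lemma oitv_sub_refl I : oitv_sub I I.
Proof. by []. Qed.

Lemma oitv_sub_trans I J L : oitv_sub I J -> oitv_sub J L -> oitv_sub I L.
Proof. exact: subset_trans. Qed.

Lemma ereal_dense (a b : \bar R) : (a < b)%E -> exists x : R, (a < x%:E < b)%E.
Proof.
case: a => [a| |]; case: b => [b| |] //.
- rewrite lte_fin => ab; exists ((a + b) / 2).
  by rewrite !lte_fin !midf_lt.
- by move=> _; exists (a + 1); rewrite lte_fin ltrDl ltr01 ltry.
- by move=> _; exists (b - 1); rewrite lte_fin ltrBlDr ltrDl ltr01 ltNyr.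
- by move=> _; exists 0; rewrite ltNyr ltry.
Qed.

Lemma oitv_subP I J :
  oitv_sub I J <-> (lo J <= lo I)%E /\ (hi I <= hi J)%E.
Proof.
split=> [IJ|[loJI hiIJ] x /andP[Ix xI]]; last first.
  by apply/andP; split; [exact: le_lt_trans loJI Ix|exact: lt_le_trans xI hiIJ].
split; rewrite leNgt; apply/negP => h.
- have /ereal_dense[x /andP[Ix]] : (lo I < Order.min (lo J) (hi I))%E.
    by rewrite lt_min h lo_lt_hi.
  rewrite lt_min => /andP[xJ xI].
  have /andP[Jx _] : oitv_set J x by apply: IJ; apply/andP.
  by have := lt_trans xJ Jx; rewrite ltxx.
- have /ereal_dense[x /andP[]] : (Order.max (lo I) (hi J) < hi I)%E.
    by rewrite gt_max lo_lt_hi h.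
  rewrite gt_max => /andP[Ix Jx] xI.
  have /andP[_ xJ] : oitv_set J x by apply: IJ; apply/andP.
  by have := lt_trans xJ Jx; rewrite ltxx.
Qed.

Lemma Omega_subproof (d : {nonneg R}) (I : oitv) :
  (lo I - d%:num%:E < hi I + d%:num%:E)%E.
Proof.
apply: (@le_lt_trans _ _ (lo I)); first by rewrite leeBlDr// leeDl// lee_fin.
by apply: lt_le_trans (lo_lt_hi I) _; rewrite leeDl// lee_fin.
Qed.

(* Infinite endpoints are fixed: -oo - d = -oo and +oo + d = +oo. *)
Definition Omega (d : {nonneg R}) (I : oitv) : oitv := OItv (Omega_subproof d I).

Lemma Omega_homo (d : {nonneg R}) I J :
  oitv_sub I J -> oitv_sub (Omega d I) (Omega d J).
Proof.
by move=> /oitv_subP[h1 h2]; apply/oitv_subP; split; [exact: leeB|exact: leeD].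
Qed.

Lemma sub_Omega (d : {nonneg R}) I : oitv_sub I (Omega d I).
Proof.
apply/oitv_subP; split; last by rewrite leeDl// lee_fin.
by rewrite leeBlDr// leeDl// lee_fin.
Qed.

Lemma sub_Omega2 (d : {nonneg R}) I : oitv_sub I (Omega d (Omega d I)).
Proof. exact: (@oitv_sub_trans _ (Omega d I)) (@sub_Omega d I) (@sub_Omega d _). Qed.

Lemma oitv_eq I J : lo I = lo J -> hi I = hi J -> I = J.
Proof.
case: I J => [a b ab] [a' b' ab'] /= ea eb; subst a' b'.
by congr OItv; exact: bool_irrelevance.
Qed.

Lemma Omega_add (d e : {nonneg R}) I :
  Omega d (Omega e I) = Omega (e%:num + d%:num)%:nng I.
Proof.
apply: oitv_eq.
- by rewrite /= -[RHS]/(lo I - (e%:num + d%:num)%:E)%E EFinD oppeD// addeA.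
- by rewrite /= -[RHS]/(hi I + (e%:num + d%:num)%:E)%E EFinD addeA.
Qed.

End intervals.

Arguments oitv_sub_refl {R} I.
Arguments oitv_sub_trans {R I J L}.
Arguments Omega_homo {R} d {I J}.
Arguments sub_Omega {R} d I.
Arguments sub_Omega2 {R} d I.

Section presheaves.
Variables (K : fieldType) (R : realType).

Record presheaf := Presheaf {
  sect :> oitv R -> lmodType K;
  res : forall I J, oitv_sub I J -> {linear sect J -> sect I};
  res_id : forall I (h : oitv_sub I I) x, res h x = x;
  res_comp : forall I J L (h : oitv_sub I J) (k : oitv_sub J L)
    (hk : oitv_sub I L) x, res h (res k x) = res hk x }.

(* Intersections need not be nonempty, hence not in the poset of intervals;
   agreement on them is agreement on every interval they contain. *)
Definition is_sheaf (F : presheaf) : Prop :=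
  forall (I : oitv R) (T : Type) (U : T -> oitv R)
    (UI : forall i, oitv_sub (U i) I),
  \bigcup_i oitv_set (U i) = oitv_set I ->
  forall s : forall i, F (U i),
  (forall i j (J : oitv R) (Ji : oitv_sub J (U i)) (Jj : oitv_sub J (U j)),
     res F Ji (s i) = res F Jj (s j)) ->
  exists! x : F I, forall i, res F (UI i) x = s i.

Record sheaf := Sheaf {
  sheaf_val :> presheaf;
  sheafP : is_sheaf sheaf_val }.

Record presheaf_hom (F G : presheaf) := PresheafHom {
  hom_app :> forall I, {linear F I -> G I};
  hom_nat : forall I J (h : oitv_sub I J) x,
    hom_app I (res F h x) = res G h (hom_app J x) }.

Section precompose.
Variable d : {nonneg R}.

Definition precomp (F : presheaf) : presheaf :=
  @Presheaf (fun I => F (Omega d I))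
    (fun I J h => res F (Omega_homo d h))
    (fun I h => res_id _)
    (fun I J L h k hk => res_comp _ _ _).

Lemma whisker_nat F G (f : presheaf_hom F G) I J (h : oitv_sub I J)
    (x : precomp F J) :
  f (Omega d I) (res (precomp F) h x) = res (precomp G) h (f (Omega d J) x).
Proof. exact: hom_nat. Qed.

Definition whisker F G (f : presheaf_hom F G) :
    presheaf_hom (precomp F) (precomp G) :=
  @PresheafHom (precomp F) (precomp G)
    (fun I => f (Omega d I)) (@whisker_nat F G f).

End precompose.

(* F \o Omega_2d is represented by (F \o Omega_d) \o Omega_d (see Omega_add),
   so F \o Omega_{0 <= 2d} is restriction along I `<=` Omega_d (Omega_d I). *)
Definition is_interleaving (d : {nonneg R}) (F G : presheaf)
    (phi : presheaf_hom (precomp d G) F)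
    (psi : presheaf_hom (precomp d F) G) : Prop :=
  (forall I (x : precomp d (precomp d F) I),
     phi I (whisker d psi I x) = res F (sub_Omega2 d I) x) /\
  (forall I (x : precomp d (precomp d G) I),
     psi I (whisker d phi I x) = res G (sub_Omega2 d I) x).

Definition interleaved (d : {nonneg R}) (F G : presheaf) : Prop :=
  exists phi psi, @is_interleaving d F G phi psi.

Definition interleaving_dist (F G : presheaf) : \bar R :=
  ereal_inf [set d%:num%:E | d in [set d : {nonneg R} | interleaved d F G]].

(* A path on [a, b] is a function on R of which only the values on [a, b]
   are used. *)
Definition path_continuous (a b : R) (gamma : R -> sheaf) : Prop :=
  forall t, t \in `[a, b] -> forall e : R, 0 < e ->
  exists2 eta : R, 0 < eta &
    forall s, s \in `[a, b] -> `|s - t| < eta ->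
      (interleaving_dist (gamma t) (gamma s) < e%:E)%E.

(* The subdivision is a :: s, as for total_variation in the library. *)
Definition path_length (a b : R) (gamma : R -> sheaf) : \bar R :=
  ereal_sup [set
    (let t := nth b (a :: s) in
     \sum_(0 <= i < size s) interleaving_dist (gamma (t i)) (gamma (t i.+1)))%E
  | s in itv_partition a b].

Definition intrinsic_dist (F G : sheaf) : \bar R :=
  ereal_inf [set l | exists a b gamma,
    [/\ a <= b, path_continuous a b gamma, gamma a = F, gamma b = G &
        l = path_length a b gamma]].

End presheaves.

(* Main.v *)
Require Import Defs.
From mathcomp Require Import all_boot all_order all_algebra.
From mathcomp Require Import all_classical all_reals all_analysis.
From mathcomp Require Import ring lra.

Import Order.TTheory GRing.Theory Num.Theory numFieldNormedType.Exports.
Local Open Scope ring_scope.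
Local Open Scope classical_set_scope.

(** Write K_S for the constant sheaf on an open set S, extended by zero.  The
two sheaves K_]-2, 2[ and 0 are at interleaving distance at most 1, because the
restriction maps that a 1-interleaving has to factor start from an interval
longer than 4, where K_]-2, 2[ has no nonzero section (lemma
[interleaving_dist_ext0]).  Any path between them nevertheless has length at
least 2.

The reason is cohomological.  A section s of F over J = ]x, y[ is a Cech
1-cocycle for the cover of the line by ]-oo, y[ and ]x, +oo[, and
[coboundary F s] says that its class vanishes, that is, that s is the sum of a
section extending to the left ray and a section extending to the right ray.
When F is a sheaf, the sections of J modulo coboundaries embed into H^1(R, F),
so restricting a section to a smaller interval, however small, cannot kill a
nonzero class ([coboundary_extend]).  This rigidity, which the sections
themselves lack, makes the size of the interval carrying a nonzero class
1-Lipschitz locally: let F and G be d-interleaved and let s over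
Omega_d (Omega_d I) have a nonzero class.  If its image over Omega_d I were a
coboundary, then so would be the restriction of s to I, hence s itself.  So the
class survives in G over an interval whose radius has decreased only by d, as
long as the interval I left after two steps is nonempty
([interleaved_obstructed]).

Along a continuous path the steps can be made arbitrarily small, so the
nonemptiness condition does not interfere, and the radius of an obstructed
interval decreases by at most the length of the path ([obstructed_path]).
K_]-2, 2[ has a nonzero class over ]-2, 2[, since its sections over rays
vanish; the zero sheaf has none at any radius.  Hence the length is at least 2,
and 2 <= c * 1.  A single 1-interleaving can jump from K_]-2, 2[ to 0 because
at the radius 2 it leaves for I just the empty interval. *)

(** * Intervals and covers *)

Section Intervals.
Set Implicit Arguments.
Unset Strict Implicit.
Context {R : realType}.
Implicit Types I J U V : oitv R.

Lemma oitv_set_neq0 I : oitv_set I !=set0.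
Proof. by have /ereal_dense[x] := lo_lt_hi I; exists x. Qed.

Lemma oitv_set_open I : open (oitv_set I).
Proof.
have -> : oitv_set I =
    [set x | (lo I < x%:E)%E] `&` [set x | (x%:E < hi I)%E].
  by apply/seteqP; split=> x /= => [/andP[]|[? ?]] //; apply/andP.
apply: openI.
- case: (lo I) => [a| |].
  + by under eq_set do rewrite lte_fin; exact: open_gt.
  + rewrite [X in open X](_ : _ = set0); first exact: open0.
    by apply/seteqP; split=> x //=; rewrite ltNge leey.
  + rewrite [X in open X](_ : _ = setT); first exact: openT.
    by apply/seteqP; split=> x //= _; rewrite ltNyr.
- case: (hi I) => [a| |].
  + by under eq_set do rewrite lte_fin; exact: open_lt.
  + rewrite [X in open X](_ : _ = setT); first exact: openT.
    by apply/seteqP; split=> x //= _; rewrite ltry.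
  + rewrite [X in open X](_ : _ = set0); first exact: open0.
    by apply/seteqP; split=> x //=; rewrite ltNge leNye.
Qed.

Lemma oitv_set_connected I : connected (oitv_set I).
Proof.
apply/connected_intervalP => x y /andP[Ix _] /andP[_ yI] z /andP[xz zy].
apply/andP; split.
- by apply: lt_le_trans Ix _; rewrite lee_fin.
- by apply: le_lt_trans yI; rewrite lee_fin.
Qed.

Lemma oitv_meet U V (x : R) : oitv_set U x -> oitv_set V x ->
  exists J, oitv_sub J U /\ oitv_sub J V.
Proof.
move=> /andP[Ux xU] /andP[Vx xV].
have lh : (Order.max (lo U) (lo V) < Order.min (hi U) (hi V))%E.
  by apply: (@lt_trans _ _ x%:E); rewrite ?gt_max ?lt_min ?Ux ?Vx ?xU ?xV.
by exists (OItv lh); split; apply/oitv_subP; split=> /=;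
   rewrite ?le_max ?ge_min lexx ?orbT.
Qed.

(** A locally constant function on an interval is constant, in the form needed
to glue sections of a constant sheaf: the indices, rather than the points, carry
the values, and the local condition only tests intervals on which two members
of the cover overlap. *)
Lemma cover_constant (A : Type) I (T : Type) (U : T -> oitv R) (v : T -> A) :
  \bigcup_i oitv_set (U i) = oitv_set I ->
  (forall i j J, oitv_sub J (U i) -> oitv_sub J (U j) -> v i = v j) ->
  forall i j, v i = v j.
Proof.
move=> cov comp i0 j.
have overlap i k x : oitv_set (U i) x -> oitv_set (U k) x -> v i = v k.
  by move=> Ui Uk; have [J [Ji Jk]] := oitv_meet Ui Uk; exact: comp Ji Jk.
pose B := \bigcup_(i in [set i | v i = v i0]) oitv_set (U i).
pose C := \bigcup_(i in [set i | v i <> v i0]) oitv_set (U i).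
have BI : B `<=` oitv_set I by rewrite -cov => x [i _ Ui]; exists i.
have EB : B = oitv_set I.
  apply: (@oitv_set_connected I).
  - by have [x Ux] := oitv_set_neq0 (U i0); exists x, i0.
  - exists B; last by rewrite setIidr.
    by apply: bigcup_open => i _; exact: oitv_set_open.
  - exists (~` C).
      by apply: open_closedC; apply: bigcup_open => i _; exact: oitv_set_open.
    apply/seteqP; split=> x.
      move=> Bx; split; first exact: BI.
      case: Bx => i /= vi Ui [k /= vk Uk]; apply: vk.
      by rewrite -vi (overlap _ _ _ Ui Uk).
    case=> Ix nCx; move: Ix; rewrite -cov => -[i _ Ui].
    exists i => //=; apply: contrapT => vi; apply: nCx.
    by exists i.
have [x Ux] := oitv_set_neq0 (U j).
have [i /= vi Ui] : B x by rewrite EB -cov; exists j.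
by rewrite -vi (overlap _ _ _ Ui Ux).
Qed.

End Intervals.

(** * Constant sheaves extended by zero *)

Section ExtensionByZero.
Set Implicit Arguments.
Unset Strict Implicit.
Context {K : fieldType} {R : realType}.
Variable S : set R.
Implicit Types I J : oitv R.

(** Sections over I form the line K when I lies in S and vanish otherwise; the
row vectors of length 1 or 0 give both cases a module structure at once. *)
Definition ext0_dim I : nat := `[< oitv_set I `<=` S >].

Lemma ext0_dim1 I : oitv_set I `<=` S -> ext0_dim I = 1%N.
Proof. by move=> IS; rewrite /ext0_dim asboolT. Qed.

Lemma ext0_dim0 I : ~ (oitv_set I `<=` S) -> ext0_dim I = 0%N.
Proof. by move=> IS; rewrite /ext0_dim asboolF. Qed.

(** The value of a constant section.  It identifies all the modules of sections
with subspaces of K, compatibly with restriction, and thereby turns equations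
between sections into equations in K. *)
Definition ext0_val I (x : 'rV[K]_(ext0_dim I)) : K := \sum_j x 0 j.

Lemma ext0_val_inj I : injective (@ext0_val I).
Proof.
rewrite /ext0_val /ext0_dim; case: asbool => /= x y; last by rewrite !thinmx0.
by rewrite !big_ord1 => xy; apply/rowP => j; rewrite ord1.
Qed.

Lemma ext0_val_outside I (x : 'rV[K]_(ext0_dim I)) :
  ~ (oitv_set I `<=` S) -> ext0_val x = 0.
Proof.
move=> /ext0_dim0 d0; rewrite /ext0_val big1// => j _.
by have := ltn_ord j; rewrite [X in (_ < X)%N]d0.
Qed.

Lemma ext0_val_surj I (a : K) : (~ (oitv_set I `<=` S) -> a = 0) ->
  exists x : 'rV[K]_(ext0_dim I), ext0_val x = a.
Proof.
move=> aS; exists (const_mx a).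
have [IS|nIS] := pselect (oitv_set I `<=` S); last first.
  by rewrite ext0_val_outside// aS.
rewrite /ext0_val (eq_bigr (fun=> a)) => [|j _]; last by rewrite mxE.
by rewrite sumr_const card_ord ext0_dim1.
Qed.

(** The all-ones matrix is the identity when both intervals lie in S, and the
zero map when the larger one does not. *)
Definition ext0_res I J (IJ : oitv_sub I J) :
    {linear 'rV[K]_(ext0_dim J) -> 'rV[K]_(ext0_dim I)} :=
  mulmxr (const_mx 1).

Lemma ext0_val_res I J (IJ : oitv_sub I J) x :
  ext0_val (ext0_res IJ x) = ext0_val x.
Proof.
have [IS|nIS] := pselect (oitv_set I `<=` S); last first.
  rewrite !ext0_val_outside// => JS.
  by apply: nIS; exact: subset_trans JS.
rewrite [LHS]/ext0_val /= (eq_bigr (fun=> ext0_val x)) => [|i _].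
  by rewrite sumr_const card_ord ext0_dim1.
by rewrite mxE /ext0_val; apply: eq_bigr => j _; rewrite mxE mulr1.
Qed.

Definition ext0_presheaf : presheaf K R.
Proof.
refine (@Presheaf K R (fun I => 'rV[K]_(ext0_dim I)) ext0_res _ _).
- by move=> I h x; apply: ext0_val_inj; rewrite ext0_val_res.
- by move=> I J L h k hk x; apply: ext0_val_inj; rewrite !ext0_val_res.
Defined.

(** Compatible sections have a common value by connectedness.  If I is not
contained in S, some member of the cover is not either, so that the common value
is zero. *)
Lemma ext0_is_sheaf : is_sheaf ext0_presheaf.
Proof.
move=> I T U UI cov s comp.
have vs i j : ext0_val (s i) = ext0_val (s j).
  apply: (cover_constant (v := fun i => ext0_val (s i)) cov).
  move=> {}i {}j J Ji Jj.
  by rewrite -(ext0_val_res Ji) -(ext0_val_res Jj); congr ext0_val; exact: comp.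
have [p Ip] := oitv_set_neq0 I.
have [i0 _ _] : (\bigcup_i oitv_set (U i)) p by rewrite cov.
have [x xE] : exists x : 'rV[K]_(ext0_dim I), ext0_val x = ext0_val (s i0).
  apply: ext0_val_surj => /existsNP[q /not_implyP[Iq nSq]].
  have [j _ Uq] : (\bigcup_i oitv_set (U i)) q by rewrite cov.
  by rewrite (vs i0 j) ext0_val_outside// => /(_ q Uq).
exists x; split=> [i|y yE]; apply: ext0_val_inj.
  by rewrite [LHS](ext0_val_res (UI i)) xE.
by rewrite xE -(yE i0) [LHS](ext0_val_res (UI i0)).
Qed.

Definition ext0 : sheaf K R := Sheaf ext0_is_sheaf.

End ExtensionByZero.

(** * Sections as Cech cocycles *)

Section Coboundaries.
Set Implicit Arguments.
Unset Strict Implicit.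
Context {K : fieldType} {R : realType}.
Implicit Types (I J A B : oitv R) (F G : presheaf K R).

Lemma glue2 {F} (sF : is_sheaf F) {I A B} (AI : oitv_sub A I) (BI : oitv_sub B I)
    (a : F A) (b : F B) :
  oitv_set I `<=` oitv_set A `|` oitv_set B ->
  (forall C (CA : oitv_sub C A) (CB : oitv_sub C B), res F CA a = res F CB b) ->
  exists x : F I, res F AI x = a /\ res F BI x = b.
Proof.
move=> cov ab.
pose U c := if c then A else B.
pose s c : F (U c) := match c with true => a | false => b end.
have UI c : oitv_sub (U c) I by case: c.
have covU : \bigcup_c oitv_set (U c) = oitv_set I.
  apply/seteqP; split=> [x [c _]|x /cov[]]; first exact: UI.
    by exists true.
  by exists false.
have comp i j C (Ci : oitv_sub C (U i)) (Cj : oitv_sub C (U j)) :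
    res F Ci (s i) = res F Cj (s j).
  case: i Ci; case: j Cj => /= Cj Ci.
  - by rewrite (Prop_irrelevance Cj Ci).
  - exact: ab.
  - by symmetry; exact: ab.
  - by rewrite (Prop_irrelevance Cj Ci).
have [x [xE _]] := sF I bool U UI covU s comp.
exists x; split.
- by have := xE true; rewrite (Prop_irrelevance (UI true) AI).
- by have := xE false; rewrite (Prop_irrelevance (UI false) BI).
Qed.

Lemma sheaf_sep2 {F} (sF : is_sheaf F) {I A B} (AI : oitv_sub A I)
    (BI : oitv_sub B I) (x y : F I) :
  oitv_set I `<=` oitv_set A `|` oitv_set B ->
  res F AI x = res F AI y -> res F BI x = res F BI y -> x = y.
Proof.
move=> cov xyA xyB.
pose U c := if c then A else B.
have UI c : oitv_sub (U c) I by case: c.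
have covU : \bigcup_c oitv_set (U c) = oitv_set I.
  apply/seteqP; split=> [z [c _]|z /cov[]]; first exact: UI.
    by exists true.
  by exists false.
have [|z [_ zU]] := sF I bool U UI covU (fun c => res F (UI c) y).
  move=> i j C Ci Cj.
  by rewrite !(res_comp _ _ (oitv_sub_trans Ci (UI i))).
rewrite -(zU y)// -(zU x)// => -[] /=.
- by rewrite (Prop_irrelevance (UI true) AI).
- by rewrite (Prop_irrelevance (UI false) BI).
Qed.

(** The two extensions may live on any intervals A and B unbounded to the left
and to the right; [coboundary_rays] shrinks them to the rays ending at J, which
form the cover of the line that computes the class of s in H^1.  Leaving them
free avoids transporting sections along equalities of intervals. *)
Definition coboundary F J (s : F J) : Prop :=
  exists A B (JA : oitv_sub J A) (JB : oitv_sub J B) (u : F A) (v : F B),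
    [/\ lo A = -oo%E, hi B = +oo%E & s = res F JA u + res F JB v].

Arguments coboundary F {J} s.

Definition left_ray I : oitv R := OItv (le_lt_trans (leNye _) (lo_lt_hi I)).
Definition right_ray I : oitv R := OItv (lt_le_trans (lo_lt_hi I) (leey _)).

Lemma sub_left_ray I : oitv_sub I (left_ray I).
Proof. by apply/oitv_subP; rewrite /= leNye. Qed.

Lemma sub_right_ray I : oitv_sub I (right_ray I).
Proof. by apply/oitv_subP; rewrite /= leey. Qed.

Arguments sub_left_ray I : clear implicits.
Arguments sub_right_ray I : clear implicits.

Lemma coboundary0 F J : coboundary F (0 : F J).
Proof.
exists (left_ray J), (right_ray J), (sub_left_ray J), (sub_right_ray J), 0, 0.
by split=> //; rewrite !raddf0 addr0.
Qed.

Lemma coboundary_rays F J (s : F J) : coboundary F s ->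
  exists (u : F (left_ray J)) (v : F (right_ray J)),
    s = res F (sub_left_ray J) u + res F (sub_right_ray J) v.
Proof.
move=> [A [B [JA [JB [u [v [loA hiB ->]]]]]]].
have /oitv_subP[_ hJA] := JA; have /oitv_subP[hJB _] := JB.
have lA : oitv_sub (left_ray J) A by apply/oitv_subP; rewrite loA.
have rB : oitv_sub (right_ray J) B by apply/oitv_subP; rewrite hiB.
exists (res F lA u), (res F rB v).
by rewrite (res_comp _ _ JA) (res_comp _ _ JB).
Qed.

(** Thickening a ray yields a ray, so a homomorphism that shrinks intervals
still maps sections on rays to sections on rays. *)
Lemma coboundary_hom {d : {nonneg R}} {F G} (f : presheaf_hom (precomp d F) G) I
    (s : F (Omega d I)) :
  coboundary F s -> coboundary G (f I s).
Proof.
move=> [A [B [JA [JB [u [v [loA hiB ->]]]]]]].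
have /oitv_subP[_ hJA] := JA; have /oitv_subP[hJB _] := JB.
have lA : oitv_sub (Omega d (left_ray I)) A by apply/oitv_subP; rewrite loA.
have rB : oitv_sub (Omega d (right_ray I)) B by apply/oitv_subP; rewrite hiB.
exists (left_ray I), (right_ray I), (sub_left_ray I), (sub_right_ray I).
exists (f _ (res F lA u)), (f _ (res F rB v)); split=> //.
rewrite -!(hom_nat f) -(raddfD (f I)); congr (f I _).
by rewrite /= (res_comp _ _ JA) (res_comp _ _ JB).
Qed.

(** The injectivity of the sections modulo coboundaries under restriction.
With J = ]x', y'[ containing I = ]x, y[ and s = u + v on I, where u lives on
]-oo, y[ and v on ]x, +oo[, the section v agrees on I with s - u, which lives on
]x', y[; they glue to a section w on ]x', +oo[.  Likewise u and s - v glue to z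
on ]-oo, y'[.  Then s = z + w on J, as can be checked on ]x', y[ and ]x, y'[. *)
Lemma coboundary_extend {F} (sF : is_sheaf F) I J (IJ : oitv_sub I J) (s : F J) :
  coboundary F (res F IJ s) -> coboundary F s.
Proof.
move=> /coboundary_rays[u [v suv]].
have /oitv_subP[lJI hIJ] := IJ.
have lhP : (lo J < hi I)%E by apply: le_lt_trans lJI (lo_lt_hi I).
have lhN : (lo I < hi J)%E by apply: lt_le_trans (lo_lt_hi I) hIJ.
pose P := OItv lhP; pose N := OItv lhN.
have PJ : oitv_sub P J by apply/oitv_subP.
have NJ : oitv_sub N J by apply/oitv_subP.
have PL : oitv_sub P (left_ray I) by apply/oitv_subP; rewrite /= leNye.
have NR : oitv_sub N (right_ray I) by apply/oitv_subP; rewrite /= leey.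
have PR : oitv_sub P (right_ray J) by apply/oitv_subP; rewrite /= leey.
have NL : oitv_sub N (left_ray J) by apply/oitv_subP; rewrite /= leNye.
have LL : oitv_sub (left_ray I) (left_ray J) by apply/oitv_subP.
have RR : oitv_sub (right_ray I) (right_ray J) by apply/oitv_subP.
have overlap x : (lo I < x%:E)%E || (x%:E < hi I)%E.
  by case: ltP => //= xI; exact: le_lt_trans xI (lo_lt_hi I).
have agree C (CJ : oitv_sub C J) (CI : oitv_sub C I)
    (CL : oitv_sub C (left_ray I)) (CR : oitv_sub C (right_ray I)) :
    res F CJ s = res F CL u + res F CR v.
  rewrite -(res_comp CI (sub_left_ray I)) -(res_comp CI (sub_right_ray I)).
  by rewrite -raddfD -suv /= (res_comp _ _ CJ).
have [||w [wP wR]] := glue2 sF PR RR (a := res F PJ s - res F PL u) (b := v).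
- move=> x /andP[Jx _]; have /orP[Ix|xI] := overlap x.
  + by right; apply/andP; rewrite ltry.
  + by left; apply/andP.
- move=> C CP CR; have CI : oitv_sub C I.
    by apply/oitv_subP; move/oitv_subP: CP => [_ ?]; move/oitv_subP: CR => [? _].
  have CJ := oitv_sub_trans CP PJ; have CL := oitv_sub_trans CP PL.
  rewrite raddfB/= (res_comp _ _ CJ) (res_comp _ _ CL).
  by rewrite (agree C CJ CI CL CR) addrAC subrr add0r.
have [||z [zL zN]] := glue2 sF LL NL (a := u) (b := res F NJ s - res F NR v).
- move=> x /andP[_ xJ]; have /orP[Ix|xI] := overlap x.
  + by right; apply/andP.
  + by left; apply/andP; rewrite ltNyr.
- move=> C CL CN; have CI : oitv_sub C I.
    by apply/oitv_subP; move/oitv_subP: CN => [? _]; move/oitv_subP: CL => [_ ?].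
  have CJ := oitv_sub_trans CN NJ; have CR := oitv_sub_trans CN NR.
  rewrite raddfB/= (res_comp _ _ CJ) (res_comp _ _ CR).
  by rewrite (agree C CJ CI CL CR) addrK.
exists (left_ray J), (right_ray J), (sub_left_ray J), (sub_right_ray J), z, w.
split=> //; apply: (sheaf_sep2 sF (AI := PJ) (BI := NJ)).
- move=> x /andP[Jx xJ]; have /orP[Ix|xI] := overlap x.
  + by right; apply/andP.
  + by left; apply/andP.
- rewrite raddfD/= (res_comp _ _ (oitv_sub_trans PL LL)) (res_comp _ _ PR).
  by rewrite -(res_comp PL LL) zL wP addrC subrK.
- rewrite raddfD/= (res_comp _ _ NL) (res_comp _ _ (oitv_sub_trans NR RR)).
  by rewrite -(res_comp NR RR) zN wR subrK.
Qed.

(** Intervals centered at 0 suffice, as the argument loses the same amount at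
both ends; their radius is then the quantity to follow along a path. *)
Definition obstructed F (r : R) : Prop :=
  exists J (s : F J), [/\ lo J = (- r)%:E, hi J = r%:E & ~ coboundary F s].

(** The bound 2 d < r makes the interval I of radius r - 2 d nonempty: it is
there that the interleaving identity is compared with the restriction of s. *)
Lemma interleaved_obstructed {d : {nonneg R}} {F G} {r : R} :
  is_sheaf F -> interleaved d F G -> 2 * d%:num < r ->
  obstructed F r -> obstructed G (r - d%:num).
Proof.
move=> sF [phi [psi [phipsi _]]] dr [J [s [loJ hiJ ncob]]].
have lt0 : ((- (r - d%:num - d%:num))%:E < (r - d%:num - d%:num)%:E)%E.
  by rewrite lte_fin; lra.
pose I := OItv lt0.
have JE : J = Omega d (Omega d I).
  by apply: oitv_eq; rewrite ?loJ ?hiJ /=; congr EFin; ring.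
subst J; exists (Omega d I), (psi (Omega d I) s); split.
- by rewrite /=; congr EFin; ring.
- by rewrite /=; congr EFin; ring.
move=> /(coboundary_hom phi).
by rewrite [phi _ _]phipsi => /(coboundary_extend sF).
Qed.

End Coboundaries.

(** * Lower bound for the length of a path *)

Section Distances.
Context {K : fieldType} {R : realType}.
Set Implicit Arguments.
Unset Strict Implicit.
Implicit Types (F G : presheaf K R) (gamma : R -> sheaf K R).

Lemma interleaved_sym {d : {nonneg R}} {F G} : interleaved d F G -> interleaved d G F.
Proof. by move=> [phi [psi [h1 h2]]]; exists psi, phi. Qed.

Lemma interleaving_dist_sym F G : interleaving_dist F G = interleaving_dist G F.
Proof.
congr ereal_inf; apply/seteqP.
by split=> _ [d dFG <-]; exists d => //; exact: interleaved_sym.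
Qed.

Lemma interleaving_dist_ge0 F G : (0 <= interleaving_dist F G)%E.
Proof. by apply: le_ereal_inf_tmp => _ [d _ <-]; rewrite lee_fin. Qed.

Lemma obstructed_shrink {F} {r r' : R} : is_sheaf F -> 0 < r' <= r ->
  obstructed F r -> obstructed F r'.
Proof.
move=> sF /andP[r'0 r'r] [J [s [loJ hiJ ncob]]].
have lt0 : ((- r')%:E < r'%:E)%E by rewrite lte_fin; lra.
have IJ : oitv_sub (OItv lt0) J.
  by apply/oitv_subP; rewrite loJ hiJ /= !lee_fin; lra.
by exists (OItv lt0), (res F IJ s); split=> // /(coboundary_extend sF).
Qed.

(** The distance is an infimum, so the interleaving found may be at some d < e;
[obstructed_shrink] then passes from r - d to r - e. *)
Lemma obstructed_dist {F G} {e r : R} : is_sheaf F -> is_sheaf G ->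
  (interleaving_dist F G < e%:E)%E -> 2 * e < r ->
  obstructed F r -> obstructed G (r - e).
Proof.
move=> sF sG /ereal_inf_lt[_ [d dFG <-]]; rewrite lte_fin => de er oF.
have d0 : 0 <= d%:num by [].
apply: obstructed_shrink sG _ (interleaved_obstructed sF dFG _ oF); last by lra.
by apply/andP; split; lra.
Qed.

(** Compactness of a segment, as an induction principle: a property that passes
along small steps to the right, where smallness is locally uniform, passes from
a to b.  The supremum of the points having the property has it and cannot be
less than b. *)
Lemma segment_chain (a b : R) (step : R -> R -> Prop) (P : R -> Prop) :
  a <= b -> P a ->
  (forall c, a <= c <= b -> exists2 eta, 0 < eta &
    forall t, a <= t <= b -> `|t - c| < eta -> step t c /\ step c t) ->
  (forall t t', a <= t -> t < t' -> t' <= b -> step t t' -> P t -> P t') ->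
  P b.
Proof.
move=> ab Pa loc ind.
pose E := [set t | a <= t <= b /\ P t]; pose c := sup E.
have Ea : E a by split; rewrite ?lexx.
have ubE : ubound E b by move=> t [/andP[]].
have hsE : has_sup E by split; [exists a|exists b].
have Ec t : E t -> t <= c by move=> Et; exact: (sup_upper_bound hsE).
have cb : c <= b by apply: ge_sup => //; exists a.
have ac : a <= c by exact: Ec.
have [eta eta0 near] := loc c (introT andP (conj ac cb)).
have Pc : P c.
  have [t Et ct] := sup_adherent eta0 hsE.
  have tc := Ec t Et; case: Et => /andP[at_ tb] Pt.
  move: (tc); rewrite le_eqVlt => /predU1P[<-//|ltc].
  have [||tcs _] := near t; first by rewrite at_.
    by rewrite ltr_norml; apply/andP; split; move: ct; rewrite -/c; lra.
  exact: ind tcs Pt.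
move: (cb); rewrite le_eqVlt => /predU1P[<-//|ltcb].
pose u := Num.min b (c + eta / 2).
have cu : c < u by rewrite lt_min ltcb /=; lra.
have ub : u <= b by rewrite ge_min lexx.
have ue : u <= c + eta / 2 by rewrite ge_min lexx orbT.
have [||_ cus] := near u.
- by apply/andP; split; lra.
- by rewrite ltr_norml; apply/andP; split; lra.
have : u <= c.
  by apply: Ec; split; [apply/andP; split; lra|exact: ind cus Pc].
by rewrite leNgt cu.
Qed.

Lemma sum_steps_rcons (x0 : R) (f : R -> R -> \bar R) (a : R) (s : seq R) (t : R) :
  (\sum_(0 <= i < size (rcons s t))
     f (nth x0 (a :: rcons s t) i) (nth x0 (a :: rcons s t) i.+1) =
   \sum_(0 <= i < size s) f (nth x0 (a :: s) i) (nth x0 (a :: s) i.+1) +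
   f (last a s) t)%E.
Proof.
rewrite size_rcons big_nat_recr//=; congr (_ + f _ _)%E.
- apply: eq_big_nat => i /andP[_ ilt]; congr f; last by rewrite nth_rcons ilt.
  by rewrite -rcons_cons nth_rcons /= ltnS ltnW.
- by rewrite -rcons_cons nth_rcons /= ltnS leqnn nth_last.
- by rewrite nth_rcons ltnn eqxx.
Qed.

(** Each subdivision with steps of size less than r / 4 lets
[obstructed_dist] act step by step, as the radius stays above r / 2.  The property
propagated along the path keeps a subdivision of the part already covered and
allows for the radius any loss larger than its total distance, which absorbs
the approximation of each distance by an interleaving. *)
Lemma obstructed_path {a b : R} {gamma} {r0 r : R} :
  a <= b -> path_continuous a b gamma -> 0 < r ->
  (path_length a b gamma + r%:E < r0%:E)%E ->
  obstructed (gamma a) r0 -> obstructed (gamma b) r.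
Proof.
move=> ab cont rgt0 Lr oa.
pose sigma s := (\sum_(0 <= i < size s) interleaving_dist
  (gamma (nth b (a :: s) i)) (gamma (nth b (a :: s) i.+1)))%E.
have sigma_ge0 s : (0 <= sigma s)%E.
  by apply: sume_ge0 => i _; exact: interleaving_dist_ge0.
pose e0 := r / 4.
pose P t := exists2 s, itv_partition a t s &
  forall r', 2 * e0 < r' -> (sigma s + r'%:E < r0%:E)%E -> obstructed (gamma t) r'.
have [s sab sP] : P b.
- apply: (@segment_chain a b (fun t t' =>
    interleaving_dist (gamma t) (gamma t') < e0%:E)%E P ab).
  + exists [::]; first by split=> //=.
    move=> r' r'gt; rewrite /sigma big_geq// add0e lte_fin => r'r0.
    apply: (@obstructed_shrink (gamma a) r0) => //; first exact: sheafP.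
    by apply/andP; split; move: r'gt; rewrite /e0; lra.
  + move=> c acb; have e0_gt0 : 0 < e0 by rewrite /e0; lra.
    have [|eta eta0 H] := cont c _ e0 e0_gt0; first by rewrite in_itv.
    exists eta => // t atb tc.
    have ct : (interleaving_dist (gamma c) (gamma t) < e0%:E)%E.
      by apply: H => //; rewrite in_itv.
    by rewrite interleaving_dist_sym.
  + move=> t t' at_ tt' t'b tt'e [s [ps /eqP ls] sP].
    exists (rcons s t').
      by split; rewrite ?last_rcons// rcons_path ps ls.
    move=> r' r'gt.
    have -> : sigma (rcons s t') =
        (sigma s + interleaving_dist (gamma t) (gamma t'))%E.
      rewrite -[in RHS]ls.
      exact: (sum_steps_rcons b
        (fun x y : R => interleaving_dist (gamma x) (gamma y))).
    have := interleaving_dist_ge0 (gamma t) (gamma t').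
    move: tt'e; case E : (interleaving_dist _ _) => [y| |] //.
    case E' : (sigma s) (sigma_ge0 s) => [x| |] //.
    rewrite !lee_fin !lte_fin => x_ge0 ye0 y0 xyr.
    (* Any e strictly between the step y and both upper bounds works. *)
    pose e := (y + Num.min e0 (r0 - x - r')) / 2.
    have ye : y < Num.min e0 (r0 - x - r').
      by rewrite lt_min ye0 /=; lra.
    have me : Num.min e0 (r0 - x - r') <= e0 by rewrite ge_min lexx.
    have mr : Num.min e0 (r0 - x - r') <= r0 - x - r' by rewrite ge_min lexx orbT.
    have -> : r' = (r' + e) - e by ring.
    apply: (@obstructed_dist (gamma t)); [exact: sheafP|exact: sheafP| | |].
    * by rewrite E lte_fin /e; lra.
    * by rewrite /e; lra.
    * by apply: sP; rewrite ?E' ?lte_fin /e; lra.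
apply: sP; first by rewrite /e0; lra.
apply: le_lt_trans Lr; apply: leeD => //.
by apply: ereal_sup_ubound; exists s.
Qed.

Lemma intrinsic_dist_obstructed (F G : sheaf K R) (r : R) :
  obstructed F r -> (forall r', 0 < r' -> ~ obstructed G r') ->
  (r%:E <= intrinsic_dist F G)%E.
Proof.
move=> oF oG; apply: le_ereal_inf_tmp => _ [a [b [gamma [ab cont ga gb ->]]]].
rewrite leNgt; apply/negP => /ereal_dense[x /andP[Lx]]; rewrite lte_fin => xr.
apply: (oG (r - x)); first by rewrite subr_gt0.
rewrite -gb; apply: (@obstructed_path a b gamma r) => //.
- by rewrite subr_gt0.
- rewrite [ltRHS](_ : _ = x%:E + (r - x)%:E)%E; first by rewrite lteD2rE.
  by rewrite -EFinD; congr EFin; ring.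
- by rewrite ga.
Qed.

End Distances.

(** * The open interval and the zero sheaf *)

Section Example.
Context {K : fieldType} {R : realType}.
Set Implicit Arguments.
Unset Strict Implicit.

Lemma oitv_subset_segment (I : oitv R) (a b : R) :
  oitv_set I `<=` [set x | a < x < b] -> (a%:E <= lo I)%E /\ (hi I <= b%:E)%E.
Proof.
move=> IS; have [x /IS /andP[ax xb]] := oitv_set_neq0 I.
have abE : (a%:E < b%:E)%E by rewrite lte_fin (lt_trans ax xb).
by have /oitv_subP : oitv_sub I (OItv abE) by move=> y /IS.
Qed.

Lemma ext0_set0 I (x : @ext0 K R set0 I) : x = 0.
Proof.
apply: ext0_val_inj; rewrite !ext0_val_outside// => I0;
  by have [y /I0] := oitv_set_neq0 I.
Qed.

Lemma ext0_set0_unobstructed (r : R) : ~ obstructed (@ext0 K R set0) r.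
Proof.
by move=> [J [s [_ _]]]; apply; rewrite [s]ext0_set0; exact: coboundary0.
Qed.

(** No ray lies in the interval, so all sections over rays vanish and the only
coboundary is 0, whereas the constant 1 is a section over the interval. *)
Lemma ext0_obstructed (r : R) : 0 < r ->
  obstructed (@ext0 K R [set x | - r < x < r]) r.
Proof.
move=> r0; set S := [set x | _].
have lt0 : ((- r)%:E < r%:E)%E by rewrite lte_fin; lra.
have JS : oitv_set (OItv lt0) `<=` S by move=> x; rewrite /oitv_set /= !lte_fin.
have [//|s s1] := @ext0_val_surj K R S (OItv lt0) 1.
exists (OItv lt0), s; split=> // -[A [B [JA [JB [u [v [loA hiB sE]]]]]]].
have u0 : u = 0.
  apply: ext0_val_inj; rewrite !ext0_val_outside// => /oitv_subset_segment[];
    by rewrite loA leeNy_eq.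
have v0 : v = 0.
  apply: ext0_val_inj; rewrite !ext0_val_outside// => /oitv_subset_segment[_];
    by rewrite hiB leye_eq.
move: s1; rewrite sE u0 v0 !raddf0 addr0 /ext0_val big1 => [|j _].
  by move/esym/eqP; rewrite oner_eq0.
by rewrite mxE.
Qed.

Lemma zero_hom_nat (F G : presheaf K R) I J (h : oitv_sub I J) (x : F J) :
  (\0 : {linear F I -> G I}) (res F h x) = res G h ((\0 : {linear F J -> G J}) x).
Proof. by rewrite raddf0. Qed.

Definition zero_hom (F G : presheaf K R) : presheaf_hom F G :=
  @PresheafHom K R F G (fun I => \0) (@zero_hom_nat F G).

(** The zero maps are an interleaving: an interval thickened twice by d is longer
than 4 d, the length of the support. *)
Lemma interleaving_dist_ext0 (d : {nonneg R}) :
  (interleaving_dist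
     (@ext0 K R [set x | (- (2 * d%:num) < x < 2 * d%:num)%R])
     (@ext0 K R set0) <= d%:num%:E)%E.
Proof.
apply: ereal_inf_lbound; exists d => //.
exists (zero_hom _ _), (zero_hom _ _); split=> I x /=; last first.
  by rewrite [LHS]ext0_set0 [RHS]ext0_set0.
have -> : x = 0.
  apply: (@ext0_val_inj _ _ _ (Omega d (Omega d I))).
  rewrite !ext0_val_outside// => /oitv_subset_segment[/=];
    have := lo_lt_hi I; case: (lo I) => [p| |] //; case: (hi I) => [q| |] //;
    by rewrite -?EFinD -?EFinB !lee_fin lte_fin; lra.
by rewrite mul0mx.
Qed.

End Example.

Theorem corollary5p7 (K : fieldType) (R : realType) (c : R) (c_ge0 : 0 <= c)
  (c_bound : forall F G : sheaf K R,
     (intrinsic_dist F G <= c%:E * interleaving_dist F G)%E) :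
  2 <= c.
Proof.
pose F := @ext0 K R [set x | - 2 < x < 2]; pose G := @ext0 K R set0.
have F2 : obstructed F 2 by exact: ext0_obstructed.
have G0 r : 0 < r -> ~ obstructed G r by move=> _; exact: ext0_set0_unobstructed.
have FG2 := intrinsic_dist_obstructed F2 G0.
have FG1 : (interleaving_dist F G <= 1)%E.
  by have := @interleaving_dist_ext0 K R (NngNum ler01); rewrite /= mulr1.
have FGc : (c%:E * interleaving_dist F G <= c%:E * 1)%E.
  by apply: lee_wpmul2l; [rewrite lee_fin|].
by rewrite -lee_fin -[leRHS]mule1 (le_trans FG2)// (le_trans (c_bound F G)).
Qed.
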